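(* Let $n$ be even, let $K_n=(V_n,E_n)$ be the complete undirected graph on $n$ nodes, and let $T\subseteq V_n$ with $|T|$ even. Let $T\text{-}\mathrm{JOINS}_n\subseteq\{0,1\}^{E_n}$ be the set of characteristic vectors of $T$-joins in $K_n$. Then $\mathrm{rc}(T\text{-}\mathrm{JOINS}_n)\ge 2^{\frac{n}{4}-1}$.
   Context: A $T$-join is an edge set $J\subseteq E_n$ such that the set of nodes of odd degree in the graph $(V_n,J)$ equals $T$. For $X\subseteq\mathbb{Z}^d$, a polyhedron $R\subseteq\mathbb{R}^d$ is called a relaxation for $X$ if $R\cap\mathbb{Z}^d=\mathrm{conv}(X)\cap\mathbb{Z}^d$. The relaxation complexity $\mathrm{rc}(X)$ is the smallest number of facets of any relaxation for $X$. *)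

(* Defs.v *)
From HB Require Import structures.
From mathcomp Require Export all_boot all_order all_algebra.
From mathcomp Require Export all_classical all_reals all_analysis.

Set Implicit Arguments.
Unset Strict Implicit.
Unset Printing Implicit Defensive.

Import Order.TTheory GRing.Theory Num.Theory.

Local Open Scope classical_set_scope.
Local Open Scope ring_scope.
Local Open Scope card_scope.

Section Polyhedra.
Context {R : realType} {I : finType}.
Implicit Types (P F X : set {ffun I -> R}).

Definition dotf (a x : {ffun I -> R}) : R := \sum_i a i * x i.

Definition polyhedron P : Prop :=
  exists (m : nat) (A : 'I_m -> {ffun I -> R}) (b : 'I_m -> R),
    P = [set x | forall j, dotf (A j) x <= b j].

Definition aff_indep (k : nat) (x : 'I_k -> {ffun I -> R}) : Prop :=
  forall c : 'I_k -> R,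
    \sum_i c i = 0 -> \sum_i c i *: x i = 0 -> forall i, c i = 0.

(* At most #|I| + 1 points of R^I are affinely independent, so the maximum
   ranges over all possible cardinalities; in particular adim set0 = -1. *)
Definition adim P : int :=
  (\max_(k < #|I|.+2 | `[< exists x : 'I_k -> {ffun I -> R},
                           aff_indep x /\ forall i, P (x i) >]) k)%N%:Z - 1.

(* As c = 0 is allowed, both P and the empty set are faces of P. *)
Definition face P F : Prop :=
  exists (c : {ffun I -> R}) (c0 : R),
    (forall x, P x -> dotf c x <= c0) /\
    F = P `&` [set x | dotf c x = c0].

(* With adim set0 = -1, the empty face is the unique facet of a single point;
   it is never a facet of a polyhedron of positive dimension. *)
Definition facet P F : Prop := face P F /\ adim F = adim P - 1.

Definition convex_hull X : set {ffun I -> R} :=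
  smallest (@convex_set R {ffun I -> R}) X.

Definition intpts : set {ffun I -> R} :=
  [set x | forall i, x i \is a Num.int].

Definition relaxation X P : Prop :=
  polyhedron P /\ P `&` intpts = convex_hull X `&` intpts.

(* The infimum of a set of naturals is its minimum when the set is nonempty,
   and +oo if X has no relaxation. *)
Definition rc X : \bar R :=
  ereal_inf [set (k%:R : R)%:E | k in
    [set k : nat | exists2 P, relaxation X P & [set F | facet P F] #= `I_k]].

End Polyhedra.

Definition edge (n : nat) : finType := {e : {set 'I_n} | #|e| == 2}.

Definition is_Tjoin (n : nat) (T : {set 'I_n}) (J : {set edge n}) : bool :=
  [set v | odd #|[set e in J | v \in val e]|]%SET == T.

Definition char_vec (R : realType) (I : finType) (J : {set I}) :
    {ffun I -> R} :=
  [ffun i => (i \in J)%:R].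

Definition Tjoins (R : realType) (n : nat) (T : {set 'I_n}) :
    set {ffun edge n -> R} :=
  [set char_vec R J | J in [set J | is_Tjoin T J]].

Arguments char_vec R {I} J.
Arguments Tjoins R {n} T.

(* Main.v *)
Require Import Defs.
From mathcomp Require Import zify ring lra.
Import Order.TTheory GRing.Theory Num.Theory.
Local Open Scope ring_scope.

Set Implicit Arguments.
Unset Strict Implicit.
Unset Printing Implicit Defensive.

(* Hiding sets.  Suppose that the full-dimensional polyhedron P misses a family
   of points whose pairwise midpoints lie in P.  In an irredundant description
   of P every inequality defines a facet, and an inequality violated by two
   members of the family would be violated by their midpoint; hence P has at
   least as many facets as the family has members.

   For n >= 4 fix nodes u <> v and a T-join J, and attach to each set A of other
   nodes the point J + sum_(w in A) {uw, vw}, plus the edge uv if |A| is even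
   (sums modulo 2).  Its odd nodes are T + {u, v}, so it is not a T-join.  If w
   lies in exactly one of A and B, then adding the path u-w-v to both points
   turns them into T-joins without changing their midpoint.  This gives 2^(n-2)
   hidden points.  Full-dimensionality: if c is constant on T-joins and t, t' are
   triangles sharing exactly the edge e, then comparing the T-joins J, J + t,
   J + t' and J + t + t' yields 2 c_e = 0.  For n <= 2 it is enough that every
   relaxation has a facet. *)

(** * Midpoints, affine independence and dimension *)

Section FacetCount.
Local Open Scope classical_set_scope.
Local Open Scope card_scope.
Context {R : realType} {I : finType}.
Local Notation V := {ffun I -> R}.
Implicit Types (P F : set V) (a x y : V).

Lemma dotfD a x y : dotf a (x + y) = dotf a x + dotf a y.
Proof. by rewrite /dotf -big_split; apply: eq_bigr => i _; rewrite ffunE mulrDr. Qed.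

Lemma dotfZ a (t : R) x : dotf a (t *: x) = t * dotf a x.
Proof. by rewrite /dotf mulr_sumr; apply: eq_bigr => i _; rewrite ffunE mulrCA. Qed.

Lemma dotf_sum (J : finType) (S : {set J}) a (x : J -> V) :
  dotf a (\sum_(j in S) x j) = \sum_(j in S) dotf a (x j).
Proof.
apply: (big_morph (dotf a) (dotfD a)).
by rewrite /dotf big1 // => i _; rewrite ffunE mulr0.
Qed.

Lemma ffun_scaleE (t : R) x i : (t *: x) i = t * x i.
Proof. by rewrite ffunE. Qed.

Definition midpoint x y : V := 2^-1 *: (x + y).

Lemma dotf_midpoint a x y :
  dotf a (midpoint x y) = (dotf a x + dotf a y) / 2.
Proof. by rewrite dotfZ dotfD mulrC. Qed.

Lemma polyhedron_midpoint P x y :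
  polyhedron P -> P x -> P y -> P (midpoint x y).
Proof.
move=> [m [A [b ->]]] /= Px Py j; rewrite dotf_midpoint.
by have := Px j; have := Py j; lra.
Qed.

Definition not_in_hyperplane P :=
  forall a b, (forall x, P x -> dotf a x = b) -> a = 0.

Definition contains_indep P k :=
  exists x : 'I_k -> V, aff_indep x /\ forall i, P (x i).

Lemma adim_eq P k : (k <= #|I|.+1)%N -> contains_indep P k ->
  (forall l, (l <= #|I|.+1)%N -> contains_indep P l -> (l <= k)%N) ->
  adim P = k%:Z - 1.
Proof.
move=> kI Pk Pmax; rewrite /adim; congr (Posz _ - 1).
apply/eqP; rewrite eqn_leq; apply/andP; split.
  apply/bigmax_leqP => -[l /= lI] /asboolP Pl; exact: Pmax.
have kI' : (k < #|I|.+2)%N by [].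
apply: (@leq_bigmax_cond _ _ (fun i : 'I__ => nat_of_ord i) (Ordinal kI')).
exact/asboolP.
Qed.

Lemma sum_enum_val (J : finType) (U : nmodType) (F : J -> U) :
  \sum_j F j = \sum_(i < #|J|) F (enum_val i).
Proof. by rewrite (reindex _ (onW_bij _ (@enum_val_bij J))). Qed.

Lemma sum_option (J : finType) (U : nmodType) (F : option J -> U) :
  \sum_o F o = F None + \sum_j F (Some j).
Proof.
rewrite (bigD1 None) //=; congr (_ + _).
rewrite (reindex_omap Some id) => [|[]//].
by apply: eq_bigl => j; rewrite /= eqxx.
Qed.

(** Affine independence makes the rows [(1, x i)] linearly independent, and the nonzero column
    [(b, -a)] annihilates them all, so their rank is at most [#|I|]. *)
Lemma hyperplane_indep a b k : a != 0 ->
  contains_indep [set x | dotf a x = b] k -> (k <= #|I|)%N.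
Proof.
move=> a0 [x [x_indep xH]].
pose X : 'M[R]_(k, #|I|) := \matrix_(i, j) x i (enum_val j).
pose ac : 'M[R]_(#|I|, 1) := \matrix_(i, j) a (enum_val i).
pose M : 'M[R]_(k, 1 + #|I|) := row_mx (const_mx 1) X.
pose w : 'M[R]_(1 + #|I|, 1) := col_mx (const_mx b) (- ac).
have Mw : M *m w = 0.
  rewrite mul_row_col; apply/matrixP => i j; rewrite !mxE big_ord1 !mxE mul1r.
  rewrite -(xH i) /dotf sum_enum_val -big_split big1 //= => l _.
  by rewrite !mxE mulrC mulrN subrr.
have w0 : w != 0.
  apply: contra a0 => /eqP w0; apply/eqP/ffunP => i.
  have /(_ (enum_rank i) ord0) : forall i j, dsubmx w i j = 0.
    by move=> i' j; rewrite w0 !mxE.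
  by rewrite col_mxKd !mxE enum_rankK ffunE => /eqP; rewrite oppr_eq0 => /eqP.
have M_free : row_free M.
  rewrite -kermx_eq0; apply/rowV0P => v /sub_kermxP.
  rewrite mul_mx_row => /eqP; rewrite row_mx_eq0 => /andP[/eqP v1 /eqP vX].
  apply/rowP => i; rewrite !mxE; apply: (x_indep (fun i => v 0 i)).
    have := congr1 (fun N : 'M[R]_1 => N 0 0) v1; rewrite !mxE => {2}<-.
    by apply: eq_bigr => l _; rewrite mxE mulr1.
  apply/ffunP => l; rewrite ffunE sum_ffunE.
  have := congr1 (fun N : 'rV[R]_#|I| => N 0 (enum_rank l)) vX.
  rewrite !mxE => {2}<-.
  by apply: eq_bigr => i' _; rewrite !mxE !ffunE enum_rankK.
have := mulmx0_rank_max Mw.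
by move: M_free; rewrite /row_free => /eqP ->; rewrite -mxrank_eq0 in w0; lia.
Qed.

Lemma contains_indep_fin (J : finType) P (x : J -> V) :
  (forall c : J -> R, \sum_j c j = 0 -> \sum_j c j *: x j = 0 ->
    forall j, c j = 0) ->
  (forall j, P (x j)) -> contains_indep P #|J|.
Proof.
move=> x_indep Px; exists (fun i => x (enum_val i)); split=> // c c0 cx0 i.
rewrite -(enum_valK i); apply: (x_indep (fun j => c (enum_rank j))).
  rewrite sum_enum_val -[RHS]c0.
  by apply: eq_bigr => j _; rewrite enum_valK.
rewrite sum_enum_val -[RHS]cx0.
by apply: eq_bigr => j _; rewrite enum_valK.
Qed.

Definition unitv (i : I) : V := [ffun j => (j == i)%:R].

Lemma indep_around P p (e : R) : e != 0 ->
  P p -> (forall i, P (p + e *: unitv i)) -> contains_indep P #|I|.+1.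
Proof.
move=> e0 Pp Pe; rewrite -card_option.
apply: (@contains_indep_fin _ _
  (fun o => if o is Some i then p + e *: unitv i else p)); last by case.
move=> c; rewrite !sum_option /= => c0 cx0.
have cI i : c (Some i) = 0.
  have /ffunP/(_ i) : e *: (\sum_i c (Some i) *: unitv i) = 0.
    rewrite -[RHS]cx0 scaler_sumr.
    under [in RHS]eq_bigr do rewrite scalerDr.
    rewrite big_split /= -scaler_suml addrA -scalerDl c0 scale0r add0r.
    by apply: eq_bigr => j _; rewrite !scalerA mulrC.
  rewrite ffun_scaleE [RHS]ffunE sum_ffunE (bigD1 i) //= big1 => [|j ji]; last first.
    by rewrite !(ffun_scaleE, ffunE) eq_sym (negPf ji) mulr0.
  by rewrite !(ffun_scaleE, ffunE) eqxx mulr1 addr0 => /eqP; rewrite mulf_eq0 (negPf e0) => /eqP.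
by case=> // ; move: c0; rewrite big1 ?addr0 // => i _.
Qed.

(* The directions [unitv i - (a i / a i0) *: unitv i0] span the kernel of [a],
   and the one for [i = i0] is zero. *)
Lemma indep_hyperplane_around P q a (e : R) (i0 : I) : e != 0 -> a i0 != 0 ->
  (forall i, P (q + e *: (unitv i - (a i / a i0) *: unitv i0))) ->
  contains_indep P #|I|.
Proof.
move=> e0 a0; apply: contains_indep_fin => c c0 cx0.
have cI i : i != i0 -> c i = 0.
  move=> ii0.
  have /ffunP/(_ i) :
      e *: (\sum_i c i *: (unitv i - (a i / a i0) *: unitv i0)) = 0.
    rewrite -[RHS]cx0 scaler_sumr.
    under [in RHS]eq_bigr do rewrite scalerDr.
    rewrite big_split /= -scaler_suml c0 scale0r add0r.
    by apply: eq_bigr => j _; rewrite !scalerA mulrC.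
  rewrite ffun_scaleE [RHS]ffunE sum_ffunE (bigD1 i) //= big1 => [|j ji]; last first.
    by rewrite !(ffun_scaleE, ffunE) eq_sym (negPf ji) (negPf ii0) mulr0 subr0 mulr0.
  rewrite !(ffun_scaleE, ffunE) eqxx (negPf ii0) mulr0 subr0 mulr1 addr0 => /eqP.
  by rewrite mulf_eq0 (negPf e0) => /eqP.
move=> i; have [->|/cI //] := eqVneq i i0.
by rewrite -[RHS]c0 (bigD1 i0) //= big1 ?addr0.
Qed.

(** * Small perturbations and facets of irredundant systems *)

Lemma small_step (J : finType) (s t : J -> R) : (forall j, 0 < s j) ->
  exists2 e : R, 0 < e & forall j, e * t j <= s j.
Proof.
(* [D] dominates every ratio of [|t j|] to [s j]; the summand 1 keeps it positive when all [t j]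
   vanish. *)
move=> s0; pose D := 1 + \sum_j `|t j| / s j.
have D0 : 0 < D.
  by rewrite ltr_pwDl // sumr_ge0 // => j _; rewrite divr_ge0 // ltW.
exists D^-1; first by rewrite invr_gt0.
move=> j; rewrite ler_pdivrMl // (le_trans (ler_norm _)) //.
rewrite -ler_pdivrMr //.
rewrite /D (bigD1 j) //= addrCA lerDl addr_ge0 // sumr_ge0 // => i _.
by rewrite divr_ge0 // ltW.
Qed.

Section IrredundantSystem.
Context (m : nat) (A : 'I_m -> V) (b : 'I_m -> R) (S : {set 'I_m}) (p : V).
Let P := [set x : V | forall j, j \in S -> dotf (A j) x <= b j].
Context (p_slater : forall j, j \in S -> dotf (A j) p < b j).

Lemma step_from (D : {set 'I_m}) (v : I -> V) q :
  (forall j, j \in D -> dotf (A j) q < b j) ->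
  exists2 e : R, 0 < e &
    forall i j, j \in D -> dotf (A j) (q + e *: v i) <= b j.
Proof.
move=> qD.
(* One [e] must serve all pairs of a direction and an inequality. Inequalities outside [D], about
   which [q] says nothing, get the dummy slack 1. *)
pose s (u : I * 'I_m) := if u.2 \in D then b u.2 - dotf (A u.2) q else 1.
have s0 u : 0 < s u by rewrite /s; case: ifP => // /qD; rewrite subr_gt0.
have [e e0 eP] := small_step (fun u => dotf (A u.2) (v u.1)) s0.
exists e => // i j jD; rewrite dotfD dotfZ.
by have := eP (i, j); rewrite /s /= jD; lra.
Qed.

Lemma adim_full : adim P = #|I|%:Z.
Proof.
have [e e0 eP] := step_from unitv p_slater.
have -> : #|I|%:Z = (#|I|.+1)%:Z - 1 by lia.
apply: adim_eq => //; apply: (indep_around (p := p) (lt0r_neq0 e0)).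
  by move=> j /p_slater /ltW.
by move=> i j; apply: eP.
Qed.

(** Only inequality [j] is tight at [q], so short moves inside its hyperplane stay in [P] and give
    [#|I|] affinely independent points; a hyperplane holds no more. *)
Lemma facet_irredundant j q : j \in S -> A j != 0 -> dotf (A j) q = b j ->
  (forall i, i \in S -> i != j -> dotf (A i) q < b i) ->
  facet P (P `&` [set x | dotf (A j) x = b j]).
Proof.
move=> jS Aj0 qj qi; split.
  by exists (A j), (b j); split=> // x; apply.
rewrite adim_full.
have [i0 Ai0] : exists i0, A j i0 != 0.
  apply/existsP; apply: contraNT Aj0; rewrite negb_exists => /forallP A0.
  by apply/eqP/ffunP => i; rewrite ffunE; have := A0 i; rewrite negbK => /eqP.
apply: adim_eq => //; last first.
  move=> l _ [x [x_indep xF]]; apply: (hyperplane_indep (b := b j) Aj0).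
  by exists x; split=> // i; case: (xF i).
pose v i := unitv i - (A j i / A j i0) *: unitv i0.
have dotu i : dotf (A j) (unitv i) = A j i.
  rewrite /dotf (bigD1 i) //= big1 => [|l li]; last by rewrite ffunE (negPf li) mulr0.
  by rewrite ffunE eqxx mulr1 addr0.
have vj i : dotf (A j) (v i) = 0.
  rewrite /v -scaleN1r dotfD !dotfZ !dotu; field.
  exact: Ai0.
have [e e0 eP] : exists2 e : R, 0 < e &
    forall i l, l \in S :\ j -> dotf (A l) (q + e *: v i) <= b l.
  by apply: step_from => l /setD1P[lj lS]; apply: qi.
apply: (indep_hyperplane_around (q := q) (lt0r_neq0 e0) Ai0) => i.
have ej : dotf (A j) (q + e *: v i) = b j by rewrite dotfD dotfZ vj mulr0 addr0.
split=> //= l lS; have [->|lj] := eqVneq l j; first by rewrite ej.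
by apply: eP; rewrite !inE lj.
Qed.

End IrredundantSystem.

(** * Counting facets by hidden points *)

Lemma card_leq_facets (J : finType) (S : {set J}) (k : nat) P (F : J -> set V) :
  (forall j, j \in S -> facet P (F j)) ->
  {in S &, injective F} -> [set G | facet P G] #= `I_k -> (#|S| <= k)%N.
Proof.
move=> FS F_inj Pk; pose f (i : 'I_#|S|) := F (enum_val i).
have f_inj : {in [set: 'I_#|S|] &, injective f}.
  by move=> i j _ _ /F_inj fij; apply/enum_val_inj/fij; apply: enum_valP.
have fS : f @` setT `<=` [set G | facet P G].
  by move=> _ [i _ <-]; apply/FS/enum_valP.
rewrite -card_le_II (card_le_eql card_II) -(card_le_eql (inj_card_eq f_inj)).
by apply: card_le_trans (subset_card_le fS) _; rewrite -(card_le_eqr Pk).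
Qed.

Lemma facets_lower_bound P (H : finType) (h : H -> V) (k : nat) :
  polyhedron P -> P !=set0 -> not_in_hyperplane P ->
  (forall u, ~ P (h u)) -> (forall u v, u != v -> P (midpoint (h u) (h v))) ->
  [set F | facet P F] #= `I_k -> (#|H| <= k)%N.
Proof.
move=> [m [A [b PE]]] [x0 Px0] Pfull hP hmid Pk.
pose Q (S : {set 'I_m}) := [set x : V | forall j, j \in S -> dotf (A j) x <= b j].
(* An inclusion-minimal subsystem still describing [P] is irredundant. *)
have [S /minsetP[/asboolP PQ Smin]] :
    {S | minset (fun S : {set 'I_m} => `[< P = Q S >]) S}.
  apply: ex_minset; exists [set: 'I_m]%SET; apply/asboolP; rewrite PE.
  by apply/seteqP; split=> x /= Px j; [move=> _|]; apply: Px; rewrite ?inE.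
(* Deleting [j] from the minimal system must admit a new point [z], which then violates [j]
   alone. *)
have z_ex j : j \in S -> exists2 z, b j < dotf (A j) z &
    forall i, i \in S -> i != j -> dotf (A i) z <= b i.
  move=> jS; apply: contrapT => noz.
  have : S :\ j = S.
    apply: Smin; last exact: subsetDl.
    apply/asboolP; rewrite PQ; apply/seteqP; split=> x /= Px i.
      by move=> /setD1P[_ iS]; apply: Px.
    move=> iS; have [->|ij] := eqVneq i j; last by apply: Px; rewrite !inE ij.
    rewrite leNgt; apply/negP => jx; apply: noz; exists x => // l lS lj.
    by apply: Px; rewrite !inE lj.
  by move/setP/(_ j); rewrite !inE eqxx jS.
have A0 j : j \in S -> A j != 0.
  move=> jS; have [z zj _] := z_ex j jS; apply/eqP => Aj0.
  have dot0 x : dotf (A j) x = 0.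
    by rewrite Aj0 /dotf big1 // => i _; rewrite ffunE mul0r.
  move: Px0; rewrite PQ => /(_ j jS); rewrite dot0.
  by move: zj; rewrite dot0; lra.
have y_ex j : exists y, j \in S -> P y /\ dotf (A j) y < b j.
  have [jS|jS] := boolP (j \in S); last by exists x0.
  have [y [Py yj]] : exists y, P y /\ dotf (A j) y < b j; last by exists y.
  apply: contrapT => noy; have /eqP[] := A0 j jS; apply: (Pfull _ (b j)) => x Px.
  apply/eqP; rewrite eq_le; move: (Px); rewrite PQ => -> //=.
  by rewrite leNgt; apply/negP => xj; apply: noy; exists x.
have [y yP] := choice y_ex.
(* The average of the [y i] is strict for every [j], because the term [y j] is. *)
have [p p_slater] : exists p, forall j, j \in S -> dotf (A j) p < b j.
  exists (#|S|%:R^-1 *: \sum_(i in S) y i) => j jS.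
  have S0 : 0 < #|S|%:R :> R.
    by rewrite ltr0n; apply/card_gt0P; exists j.
  rewrite dotfZ dotf_sum ltr_pdivrMl // mulr_natl -sumr_const.
  rewrite (bigD1 j) //= [ltRHS](bigD1 j) //=; apply: ltr_leD.
    by case: (yP j jS).
  apply: ler_sum => i /andP[iS _].
  by have [+ _] := yP i iS; rewrite PQ; apply.
(* [q] is the point where the segment from [p] to [z] meets hyperplane [j]. As [t < 1], the other
   inequalities inherit strictness from [p]. *)
have q_ex j : exists q, j \in S -> dotf (A j) q = b j /\
    forall i, i \in S -> i != j -> dotf (A i) q < b i.
  have [jS|jS] := boolP (j \in S); last by exists x0.
  have [z zj zi] := z_ex j jS; have pj := p_slater j jS.
  pose d := dotf (A j) z - dotf (A j) p.
  have d0 : 0 < d by rewrite /d; lra.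
  pose t := (b j - dotf (A j) p) / d.
  have t0 : 0 < t by rewrite divr_gt0 // subr_gt0.
  have t1 : t < 1 by rewrite ltr_pdivrMr // mul1r /d; lra.
  exists (p + t *: (z - p)) => _.
  have dotE i : dotf (A i) (p + t *: (z - p))
      = (1 - t) * dotf (A i) p + t * dotf (A i) z.
    by rewrite -scaleN1r dotfD !dotfZ dotfD dotfZ; ring.
  split.
    have td : t * d = b j - dotf (A j) p by rewrite /t divfK // lt0r_neq0.
    by rewrite dotE; move: td; rewrite /d; lra.
  move=> i iS ij; rewrite dotE; have := zi i iS ij; have := p_slater i iS.
  by nra.
have [q qP] := choice q_ex.
pose F j := Q S `&` [set x | dotf (A j) x = b j].
have SK : (#|S| <= k)%N.
  apply: (@card_leq_facets _ S k (Q S) F); rewrite -?PQ //.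
    move=> j jS; have [qj qi] := qP j jS.
    rewrite PQ; exact: (facet_irredundant p_slater jS (A0 j jS) qj qi).
  (* Distinct indices give distinct facets: [q i] lies in [F i] but is strict for [j]. *)
  move=> i j iS jS FE; apply/eqP; apply: contraT => ij.
  have [qi ql] := qP i iS.
  have : F i (q i).
    split=> //= l lS; have [->|li] := eqVneq l i; first by rewrite qi.
    by rewrite ltW // ql.
  by rewrite FE => -[_ /= qj]; have := ql j jS; rewrite eq_sym ij qj ltxx => /(_ isT).
apply: leq_trans SK.
have g_ex u : exists j, j \in S /\ b j < dotf (A j) (h u).
  apply: contrapT => noj; apply: (hP u); rewrite PQ => j jS.
  by rewrite leNgt; apply/negP => jh; apply: noj; exists j.
have [g gP] := choice g_ex.
rewrite -(card_imset _ (f := g)).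
  by apply: subset_leq_card; apply/fintype.subsetP => j /imsetP[u _ ->]; case: (gP u).
move=> u v guv; apply/eqP; apply: contraT => uv.
have := hmid u v uv; rewrite PQ => /(_ (g u)); rewrite dotf_midpoint.
case: (gP u) => gS gu; case: (gP v) => _; rewrite -guv => gv /(_ gS).
by lra.
Qed.

(** The equation 0 = 1 cuts out the empty face, whose dimension -1 is one less than that of a
    point. *)
Lemma facets_of_point (x0 : V) :
  facet [set x0] set0.
Proof.
split.
  exists 0, 1; have dot0 x : dotf (0 : {ffun I -> R}) x = 0.
    by rewrite /dotf big1 // => i _; rewrite ffunE mul0r.
  split=> [x _|]; first by rewrite dot0 ler01.
  apply/esym; rewrite -subset0 => x [_ /= /eqP]; rewrite dot0.
  by rewrite eq_sym oner_eq0.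
have -> : adim [set x0] = 1%:Z - 1.
  apply: adim_eq => //.
    exists (fun=> x0); split=> // c c0 _ i; rewrite (ord1 i).
    by move: c0; rewrite big_ord1.
  move=> l _ [x [x_indep xE]]; rewrite leqNgt; apply/negP => l1.
  pose i0 := Ordinal (ltnW l1); pose i1 := Ordinal l1.
  (* All the points coincide, so weights 1 and -1 on two indices are an affine dependence. *)
  pose c (i : 'I_l) : R := (i == i0)%:R - (i == i1)%:R.
  have c0 : \sum_i c i = 0.
    rewrite sumrB (bigD1 i0) //= big1 => [|i /negPf -> //].
    by rewrite (bigD1 i1) //= big1 => [|i /negPf -> //]; rewrite addr0 subrr.
  have cx0 : \sum_i c i *: x i = 0.
    rewrite -[RHS](scale0r x0) -c0 scaler_suml.
    by apply: eq_bigr => i _; rewrite (xE i).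
  have := x_indep c c0 cx0 i0; rewrite /c -!val_eqE /= subr0 => /eqP.
  by rewrite oner_eq0.
rewrite subrr; apply: (adim_eq (k := 0)) => //.
  by exists (fun=> x0); split=> [c _ _ []|[]].
by move=> [//|l] _ [x [_ /(_ ord0)]].
Qed.

(** Shows that a relaxation contains no 0/1 points beyond the given ones. On 0/1 points [phi] is the
    Hamming distance to [J0]: at least 1 on every other vertex, hence on their hull, but 0 at
    [J0]. *)
Lemma char_vec_convex_hull (Y : set {set I}) J0 :
  convex_hull [set char_vec R J | J in Y] (char_vec R J0) -> Y J0.
Proof.
(* The linear inequality cutting off the vertex [char_vec R J0] of the cube. *)
pose phi (x : {ffun I -> R}) := \sum_e (if e \in J0 then 1 - x e else x e).
move=> J0Y; apply: contrapT => nYJ0.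
have : [set x | 1 <= phi x] (char_vec R J0).
  apply: (smallest_sub _ _ J0Y) => [x y l|_ [J YJ <-]] /=.
    rewrite !inE /= => x1 y1.
    change (is_true (1 <= phi (l%:num *: x + (1 - l%:num) *: y))).
    have -> : phi (l%:num *: x + (1 - l%:num) *: y)
        = l%:num * phi x + (1 - l%:num) * phi y.
      rewrite /phi !mulr_sumr -big_split; apply: eq_bigr => e _.
      rewrite ffunE !ffun_scaleE; case: ifP => _ /=; ring.
    have l0 : 0 <= l%:num by [].
    have l1 : l%:num <= 1 by [].
    nra.
  have [e eJ] : exists e, (e \in J) != (e \in J0).
    apply/existsP; apply: contraPT YJ; rewrite negb_exists => /forallP JE YJ.
    apply: nYJ0; suff <- : J = J0 by [].
    by apply/setP => e; have := JE e; rewrite negbK => /eqP.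
  rewrite /phi (bigD1 e) //= ffunE.
  have -> : (if e \in J0 then 1 - (e \in J)%:R else (e \in J)%:R) = 1 :> R.
    by case: (e \in J) eJ; case: (e \in J0) => //= _; rewrite subr0.
  rewrite lerDl sumr_ge0 // => i _; rewrite ffunE.
  by case: ifP => _; case: (i \in J); rewrite /= ?subrr ?subr0.
rewrite /= /phi big1 ?ler10 // => e _; rewrite ffunE.
by case: (e \in J0); rewrite //= subrr.
Qed.

End FacetCount.

(** * Degree parities in the complete graph *)

Section Joins.
Context {n : nat}.
Implicit Types (T : {set 'I_n}) (g : edge n -> bool) (u v w x : 'I_n).

(** With edge sets as Boolean functions, symmetric difference is pointwise [addb] and degree parity
    is additive. *)
Definition odeg g x : bool := \big[addb/false]_(e : edge n | x \in val e) g e.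

(** For [u = w] this is the empty edge set, so [odeg_link] holds without a side condition. *)
Definition link u w : edge n -> bool := fun e => val e == [set u; w]%SET.

Definition path2 u v w : edge n -> bool := fun e => link u w e (+) link v w e.

Definition joins T g := forall x, odeg g x = (x \in T).

Lemma is_TjoinP T g : reflect (joins T g) (is_Tjoin T [set e | g e]%SET).
Proof.
have oddE x : odd #|[set e in [set e | g e] | x \in val e]%SET| = odeg g x.
  rewrite -sum1_card (big_morph odd oddD (erefl : odd 0 = false)) /odeg [RHS]big_mkcond.
  rewrite [LHS]big_mkcond; apply: eq_bigr => e _; rewrite !inE.
  by case: (g e); case: (x \in val e).
apply: (iffP eqP) => [<- x|gT]; first by rewrite inE oddE.
by apply/setP => x; rewrite inE oddE gT.
Qed.

Lemma odegD g h x : odeg (fun e => g e (+) h e) x = odeg g x (+) odeg h x.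
Proof. exact: big_split. Qed.

Lemma odeg_sum (A : {set 'I_n}) (g : 'I_n -> edge n -> bool) x :
  odeg (fun e => \big[addb/false]_(w in A) g w e) x
  = \big[addb/false]_(w in A) odeg (g w) x.
Proof. exact: exchange_big. Qed.

Lemma odeg_link u w x : odeg (link u w) x = (x == u) (+) (x == w).
Proof.
have [<-|uw] := eqVneq u w.
  rewrite addbb /odeg big1 // => e _; apply/negbTE/eqP => eE.
  by have := valP e; rewrite eE finset.setUid cards1.
have e0P : #|[set u; w]%SET| == 2 by rewrite cards2 uw.
have linkE e : link u w e = (e == Sub [set u; w]%SET e0P) by [].
rewrite /odeg (eq_bigr _ (fun e _ => linkE e)) big_mkcond.
rewrite (bigD1 (Sub [set u; w]%SET e0P)) //= big1 => [|e /negPf ->]; last first.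
  by case: ifP.
rewrite eqxx addbF !inE; have [->|xu] := eqVneq x u; last by case: (x == w).
by rewrite (negPf uw).
Qed.

Lemma odeg_path2 u v w x : odeg (path2 u v w) x = (x == u) (+) (x == v).
Proof. by rewrite odegD !odeg_link; case: (x == u); case: (x == v); case: (x == w). Qed.

Lemma path2_mid u v w e : path2 u v w e -> w \in val e.
Proof. by rewrite /path2 /link; case: eqP => [-> _|_ /eqP ->]; rewrite !inE eqxx orbT. Qed.

Lemma path2_sub u v w e x : path2 u v w e -> x \in val e ->
  [|| x == u, x == v | x == w].
Proof.
rewrite /path2 /link; case: eqP => [-> _|_ /eqP ->]; rewrite !inE;
  by case/orP=> ->; rewrite ?orbT.
Qed.

Lemma path2_link u v w e : w \notin [set u; v]%SET -> path2 u v w e ->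
  link u v e = false.
Proof.
by move=> wuv /path2_mid we; apply: contraNF wuv => /eqP <-.
Qed.

Lemma path2_inj u v w w' e : w' \notin [set u; v]%SET -> path2 u v w e ->
  path2 u v w' e = (w' == w).
Proof.
move=> w'uv we; apply/idP/eqP => [|-> //] /path2_mid /(path2_sub we).
by move: w'uv; rewrite !inE negb_or => /andP[/negPf -> /negPf ->] /eqP.
Qed.

Lemma addb_const (A : {set 'I_n}) (c : bool) :
  \big[addb/false]_(w in A) c = odd #|A| && c.
Proof.
case: c; last by rewrite big1 ?andbF.
by rewrite -sum1_card (big_morph odd oddD (erefl : odd 0 = false)) andbT.
Qed.

(** Take the star from some [r] in [T] to [T], where the term [t = r] is empty. The centre is
    counted [#|T|] times, an even number, which leaves one count for each [t] in [T]. *)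
Lemma joins_exist T : ~~ odd #|T| -> exists g, joins T g.
Proof.
move=> T_even; have [->|[r rT]] := set_0Vmem T.
  by exists (fun=> false) => x; rewrite inE /odeg big1.
exists (fun e => \big[addb/false]_(t in T) link r t e) => x.
rewrite odeg_sum (eq_bigr _ (fun t _ => odeg_link r t x)) big_split /=.
rewrite addb_const (negPf T_even) addFb big_mkcond (bigD1 x) //= eqxx big1 => [|t tx]; last first.
  by rewrite eq_sym (negPf tx); case: ifP.
by case: ifP.
Qed.

(** The edge [uv] is added for even [#|A|] so that the number of paths joining [u] to [v] is always
    odd. *)
Definition detour (A : {set 'I_n}) u v : edge n -> bool := fun e =>
  \big[addb/false]_(w in A) path2 u v w e (+) (~~ odd #|A| && link u v e).

Lemma odeg_detour (A : {set 'I_n}) u v x :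
  odeg (detour A u v) x = (x == u) (+) (x == v).
Proof.
rewrite odegD odeg_sum (eq_bigr _ (fun w _ => odeg_path2 u v w x)) addb_const.
case: (odd #|A|) => /=; last by rewrite -odeg_link.
by rewrite /odeg big1 ?addbF.
Qed.

(** An edge of the path u-w-v lies on no path u-t-v with [t != w] and is not [uv], so only the
    summand of [w] can contribute. *)
Lemma detour_path2 (A : {set 'I_n}) u v w e : A \subset ~: [set u; v]%SET ->
  w \notin [set u; v]%SET -> path2 u v w e -> detour A u v e = (w \in A).
Proof.
move=> /fintype.subsetP Auv wuv we; rewrite /detour (path2_link wuv we) andbF addbF.
rewrite big_mkcond (bigD1 w) //= we big1 ?addbF => [|t tw]; first by case: ifP.
case: ifP => // /Auv; rewrite finset.in_setC => tuv.
by rewrite (path2_inj tuv we) (negPf tw).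
Qed.

End Joins.

(** * Hidden points and facets of relaxations *)

Section TjoinRelaxations.
Local Open Scope classical_set_scope.
Local Open Scope card_scope.
Context {R : realType} {n : nat}.
Context (T : {set 'I_n}).

Definition chi (g : edge n -> bool) : {ffun edge n -> R} :=
  char_vec R [set e | g e]%SET.

Lemma chiE g e : chi g e = (g e)%:R.
Proof. by rewrite ffunE inE. Qed.

Lemma relaxation_chi P g :
  relaxation (Tjoins R T) P -> P (chi g) <-> joins T g.
Proof.
move=> [_ PX]; have chi_int : intpts (chi g).
  by move=> e; rewrite chiE; apply: rpred_nat.
split=> [Pg|gT].
  have : (P `&` intpts) (chi g) by [].
  by rewrite PX => -[/char_vec_convex_hull /is_TjoinP].
suff : (P `&` intpts) (chi g) by case.
rewrite PX; split=> //; apply: sub_gen_smallest.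
by exists [set e | g e]%SET => //=; exact/is_TjoinP.
Qed.

Lemma joins_hyperplane_free P g : (3 < n)%N -> relaxation (Tjoins R T) P ->
  joins T g -> not_in_hyperplane P.
Proof.
move=> n3 relP gT a b aP; apply/ffunP => e; rewrite [RHS]ffunE.
have /cards2P [u [v [uv eE]]] := valP e.
(* Two further nodes serve as apexes of the triangles [t w] and [t w'] on the edge [e]. *)
have : (1 < #|~: [set u; v]%SET|)%N.
  by have := cardsC [set u; v]%SET; rewrite card_ord cards2 uv; lia.
case/card_gt1P => w [w' []]; rewrite !finset.in_setC => wuv w'uv ww'.
pose t w : edge n -> bool := fun f => path2 u v w f (+) link u v f.
have t0 x y : odeg (t x) y = false by rewrite odegD odeg_path2 odeg_link addbb.
have te x : x \notin [set u; v]%SET -> t x e.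
  move=> xuv; have luv : link u v e by rewrite /link eE.
  by rewrite /t luv addbT; apply/negP => /(path2_link xuv); rewrite luv.
have tt f : f != e -> t w f && t w' f = false.
  move=> fe; have -> : t w f = path2 u v w f.
    rewrite /t /link; case: eqP => [fE|]; last by rewrite addbF.
    by case/eqP: fe; apply: val_inj; rewrite fE eE.
  apply/negP => /andP[wf]; rewrite /t (path2_link wuv wf) addbF.
  by rewrite (path2_inj w'uv wf) eq_sym (negPf ww').
have chiP h : (forall x, odeg h x = odeg g x) -> dotf a (chi h) = b.
  by move=> hg; apply/aP/(relaxation_chi _ relP) => x; rewrite hg.
pose g1 f := g f (+) t w f; pose g2 f := g f (+) t w' f.
pose g12 f := g1 f (+) t w' f.
have : dotf a (chi g1) + dotf a (chi g2) - (dotf a (chi g) + dotf a (chi g12)) = 0.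
  by rewrite !chiP ?subrr // => x; rewrite /g12 /g1 /g2 !(odegD _ (t _)) !t0 !addbF.
(* Off [e] the triangles are disjoint and the terms cancel. At [e] both triangles flip [g], which
   leaves [a e] times 2 or -2. *)
rewrite /dotf -!big_split -sumrB /= (bigD1 e) //= big1 => [|f fe].
  rewrite !chiE /g12 /g1 /g2 !te //= addr0.
  by case: (g e); rewrite /= ?mulr1 ?mulr0; lra.
rewrite !chiE /g12 /g1 /g2; have := tt f fe.
by case: (t w f); case: (t w' f) => //= _; case: (g f) => /=; ring.
Qed.

Lemma hiding_bound P k : (3 < n)%N -> ~~ odd #|T| ->
  relaxation (Tjoins R T) P -> [set F | facet P F] #= `I_k ->
  (2 ^ (n - 2) <= k)%N.
Proof.
move=> n3 T_even relP; have [g gT] := joins_exist T_even.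
pose u : 'I_n := Ordinal (ltn_trans (isT : 0 < 3)%N n3).
pose v : 'I_n := Ordinal (ltn_trans (isT : 1 < 3)%N n3).
have uv : u != v by [].
pose W := (~: [set u; v])%SET.
pose H := {A : {set 'I_n} | A \in powerset W}.
have <- : #|{: H}| = (2 ^ (n - 2))%N.
  rewrite card_sig card_powerset; congr (2 ^ _)%N.
  by have := cardsC [set u; v]%SET; rewrite card_ord cards2 uv -/W; move: #|W| => c; lia.
pose h (A : H) e := g e (+) detour (val A) u v e.
have HW (A : H) : val A \subset W by rewrite -powersetE; apply: valP.
apply: (@facets_lower_bound _ _ P H (fun A => chi (h A))).
- by case: relP.
- by exists (chi g); apply/(relaxation_chi _ relP).
- exact: joins_hyperplane_free n3 relP gT.
- move=> A /(relaxation_chi _ relP) /(_ u); rewrite odegD odeg_detour gT eqxx.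
  by rewrite (negPf uv); case: (u \in T).
move=> A B AB.
have [w wAB] : exists w, (w \in val A) != (w \in val B).
  apply/existsP; apply: contraNT AB; rewrite negb_exists => /forallP ABE.
  by apply/eqP/val_inj/setP => w; have := ABE w; rewrite negbK => /eqP.
have wuv : w \notin [set u; v]%SET.
  rewrite -finset.in_setC; move: wAB.
  case wA: (w \in val A); last case wB: (w \in val B) => //.
    by move=> _; apply: (fintype.subsetP (HW A)).
  by move=> _; apply: (fintype.subsetP (HW B)).
pose swap C e := h C e (+) path2 u v w e.
have swapP C : P (chi (swap C)).
  apply/(relaxation_chi _ relP) => x; rewrite odegD odegD odeg_detour odeg_path2.
  by rewrite gT -addbA addbb addbF.
(* On each path edge exactly one of [h A] and [h B] is true, so flipping both merely exchanges their
   values. *)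
have -> : midpoint (chi (h A)) (chi (h B)) = midpoint (chi (swap A)) (chi (swap B)).
  congr (_ *: _); apply/ffunP => e; rewrite [LHS]ffunE [RHS]ffunE !chiE /swap.
  case we: (path2 u v w e); last by rewrite !addbF.
  rewrite /h !(detour_path2 (HW _) wuv we) !addbT.
  by move: wAB; do 2![case: (w \in _) => //]; case: (g e) => _ /=; rewrite addrC.
by apply: polyhedron_midpoint => //; case: relP.
Qed.

(** There is at most one edge. If [P] has a point besides [chi g], it lies in no hyperplane and a
    single hidden point suffices; otherwise [P] is a point and its empty face is a facet. *)
Lemma facet_exists P k : (n <= 2)%N -> ~~ odd #|T| ->
  relaxation (Tjoins R T) P -> [set F | facet P F] #= `I_k -> (0 < k)%N.
Proof.
move=> n2 T_even relP Pk; have [g gT] := joins_exist T_even.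
have Pg : P (chi g) by apply/(relaxation_chi _ relP).
have edgeE (e f : edge n) : e = f.
  have valE (e' : edge n) : val e' = [set: 'I_n]%SET.
    apply/eqP; rewrite eqEcard finset.subsetT cardsT card_ord.
    by rewrite (eqP (valP e')).
  by apply: val_inj; rewrite !valE.
have [[x [Px [e xe]]]|P1] := pselect (exists x, P x /\ exists e, x e != chi g e).
  rewrite -[1%N]card_unit.
  (* Toggling the only edge changes the parity at its ends, so [h] is no T-join. *)
  pose h f := g f (+) (f == e).
  apply: (@facets_lower_bound _ _ P unit (fun=> chi h)) Pk => //.
  - by case: relP.
  - by exists x.
  - move=> a b aP; apply/ffunP => f; rewrite (edgeE f e) [RHS]ffunE.
    have dotE y : dotf a y = a e * y e.
      by rewrite /dotf (bigD1 e) //= big1 ?addr0 // => f' /eqP[].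
    have : a e * (x e - chi g e) = 0.
      by rewrite mulrBr -!dotE !aP ?subrr.
    by move/eqP; rewrite mulf_eq0 subr_eq0 (negPf xe) orbF => /eqP.
  - have /cards2P [u [v [uv eE]]] := valP e.
    move=> _ /(relaxation_chi _ relP) /(_ u); rewrite odegD gT.
    have -> : odeg (eq_op^~ e) u = true.
      by rewrite /odeg (bigD1 e) /= ?eE ?inE ?eqxx // big1 // => f /andP[_ /negPf].
    by case: (u \in T).
have PE : P = [set chi g].
  apply/seteqP; split=> y /=; last by move=> ->.
  move=> Py; apply/ffunP => e; apply/eqP; apply: contraT => ye.
  by case: P1; exists y; split=> //; exists e.
rewrite -card_unit -cardsT.
apply: (card_leq_facets (F := fun=> set0) _ _ Pk); last by move=> [] [].
by move=> _ _; rewrite PE; apply: facets_of_point.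
Qed.

End TjoinRelaxations.

Theorem theorem8 (R : realType) (n : nat) (T : {set 'I_n})
    (n_even : ~~ odd n) (T_even : ~~ odd #|T|) :
  (((2 `^ (n%:R / 4 - 1) : R)%:E) <= rc (Tjoins R T))%E.
Proof.
apply: le_ereal_inf_tmp => _ [k [P relP Pk] <-]; rewrite lee_fin.
have [n3|n3] := ltnP 3 n.
  have kn := hiding_bound n3 T_even relP Pk.
  apply: (@le_trans _ _ (2 ^+ (n - 2))); last by rewrite -natrX ler_nat.
  rewrite -powR_mulrn // ler_powR ?ler1n // natrB; last by lia.
  have : 4 <= n%:R :> R by rewrite (ler_nat R 4).
  by lra.
(* Parity excludes [n = 3]; the exponent is now negative, so one facet is enough. *)
have n2 : (n <= 2)%N by lia.
apply: (@le_trans _ _ 1); last by rewrite ler1n (facet_exists n2 T_even relP Pk).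
rewrite -[leRHS](powRr0 2) ler_powR ?ler1n //.
have : n%:R <= 2 :> R by rewrite (ler_nat R n 2).
by lra.
Qed.
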